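(* Let $d=(\log(n+3))_{n\in\mathbb{N}_0}$, in which case $1\le d_n\uparrow\infty$. (i) The Cesàro operator $C_1$ exists in $h_d$, that is, $C_1(h_d)\subseteq h_d$ and $C_1\in\mathcal{L}(h_d)$. (ii) The point spectrum $\sigma_{pt}(C_1;h_d)=\emptyset$. (iii) The inclusions $$\Big\{z\in\mathbb{C}:\Big|z-\frac12\Big|<\frac12\Big\}\cup\{1\}\subseteq\sigma_{pt}(C_1';h_d')\subseteq\sigma_r(C_1;h_d)$$ are valid. In particular, $\{z\in\mathbb{C}:|z-\frac12|\le\frac12\}\subseteq\sigma(C_1;h_d)$. (iv) The operator $C_1\in\mathcal{L}(h_d)$ is not compact, not mean ergodic and not supercyclic.
   Context: Sequences are complex and indexed by $\mathbb{N}_0=\{0,1,2,\dots\}$. For a sequence $1\le d_n\uparrow\infty$, the generalized Hahn space $h_d$ is the Banach space of all $x\in c_0$ (null sequences) with $\|x\|_{h_d}:=\sum_{k=0}^\infty d_k|x_{k+1}-x_k|<\infty$. $C_1x=\big(\frac{x_0+x_1+\dots+x_n}{n+1}\big)_{n\in\mathbb{N}_0}$. $\mathcal{L}(X)$ is the space of bounded linear operators on a Banach space $X$, $X'$ is the topological dual and $T'\in\mathcal{L}(X')$ is the dual operator of $T\in\mathcal{L}(X)$. $\sigma(T;X)$ and $\sigma_{pt}(T;X)$ are the spectrum and point spectrum (set of eigenvalues); the residual spectrum $\sigma_r(T;X)$ is the set of $\lambda\in\mathbb{C}$ such that $\lambda I-T$ is injective and its range is not dense in $X$. With $T_{[n]}:=\frac1n\sum_{m=1}^nT^m$,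 $T$ is mean ergodic if $(T_{[n]})_{n\geq 1}$ converges in the strong operator topology; supercyclic if there is $x\in X$ with $\{\lambda T^nx:\lambda\in\mathbb{C},n\in\mathbb{N}_0\}$ dense in $X$. *)

(* Defs.v *)
From HB Require Import structures.
From mathcomp Require Import all_boot all_order all_algebra.
From mathcomp Require Import all_classical all_reals all_analysis.
From mathcomp Require Import complex ring.

Set Implicit Arguments.
Unset Strict Implicit.
Unset Printing Implicit Defensive.
Import Order.TTheory GRing.Theory Num.Theory.
Import numFieldNormedType.Exports.
Import Normc.

Local Open Scope classical_set_scope.
Local Open Scope ring_scope.
Local Open Scope complex_scope.

Section BoundedOperators.
Context {K : numFieldType}.

Section BoundedOp.
Variables X Y : normedModType K.

(* Boundedness is stated as continuity: linear_bounded_continuous. *)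
Definition bounded_op_pred : {pred X -> Y} :=
  [pred T : X -> Y | `[< linear T /\ continuous T >]].

Fact bounded_op_submod_closed : submod_closed bounded_op_pred.
Proof.
split.
  apply/asboolP; split.
    by move=> a u v; rewrite -[RHS]/(a *: 0 + 0) scaler0 addr0.
  by move=> x; apply: cvg_cst.
move=> a f g /asboolP[lf cf] /asboolP[lg cg].
apply/asboolP; split.
  move=> b u v.
  rewrite -[LHS]/(a *: f _ + g _) -[RHS]/(b *: (a *: f _ + g _) + (_ + _)).
  by rewrite lf lg !scalerDr !scalerA addrACA [a * b]mulrC.
by move=> x; apply: cvgD; [apply: cvgZl_tmp; exact: cf|exact: cg].
Qed.

HB.instance Definition _ :=
  GRing.isSubmodClosed.Build _ _ bounded_op_pred bounded_op_submod_closed.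

(* L(X, Y), and L(X) when Y = X *)
Record bounded_op := BoundedOp {
  op_fun :> X -> Y;
  op_funP : op_fun \in bounded_op_pred }.

HB.instance Definition _ := [isSub for op_fun].
HB.instance Definition _ := [Choice of bounded_op by <:].
HB.instance Definition _ := [SubChoice_isSubLmodule of bounded_op by <:].

Lemma op_linear (T : bounded_op) : linear T.
Proof. by have /asboolP[] := op_funP T. Qed.

Lemma op_continuous (T : bounded_op) : continuous T.
Proof. by have /asboolP[] := op_funP T. Qed.

End BoundedOp.

Definition dual (X : normedModType K) := bounded_op X K^o.

Fact dual_op_subproof (X : normedModType K) (T : bounded_op X X) (f : dual X) :
  (f \o T : X -> K^o) \in @bounded_op_pred X K^o.
Proof.
apply/asboolP; split.
  by move=> a u v; rewrite /= !op_linear.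
by move=> x; apply: continuous_comp; exact: op_continuous.
Qed.

Definition dual_op (X : normedModType K) (T : bounded_op X X) (f : dual X) :
  dual X := BoundedOp (dual_op_subproof T f).

(* Eigenvalues only involve the linear structure, so this also applies to
   dual_op T on the vector space dual X. *)
Definition point_spectrum (V : lmodType K) (T : V -> V) : set K :=
  [set l | exists2 x, x != 0 & T x = l *: x].

Definition spectrum (X : normedModType K) (T : bounded_op X X) : set K :=
  [set l | ~ exists S : bounded_op X X,
    (forall x, S (l *: x - T x) = x) /\ (forall y, l *: S y - T (S y) = y)].

Definition residual_spectrum (X : normedModType K) (T : bounded_op X X) :
    set K :=
  [set l | injective (fun x => l *: x - T x) /\
    ~ dense (range (fun x => l *: x - T x))].

Definition compact_op (X Y : normedModType K) (T : bounded_op X Y) : Prop :=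
  precompact (T @` [set x | `|x| <= 1]).

Definition ergodic_mean (X : normedModType K) (T : bounded_op X X) (n : nat)
    (x : X) : X :=
  n%:R^-1 *: \sum_(1 <= m < n.+1) iter m T x.

Definition mean_ergodic (X : normedModType K) (T : bounded_op X X) : Prop :=
  exists P : bounded_op X X,
    forall x, ergodic_mean T n x @[n --> \oo] --> P x.

Definition supercyclic (X : normedModType K) (T : bounded_op X X) : Prop :=
  exists x, dense [set y | exists (l : K) (n : nat), y = l *: iter n T x].

End BoundedOperators.

Lemma null_seqP (K : numFieldType) (V : normedModType K) (a : K)
    (x y : nat -> V) :
  x @ \oo --> (0 : V) -> y @ \oo --> (0 : V) -> (a *: x + y) @ \oo --> (0 : V).
Proof.
move=> x0 y0; have := cvgD (cvgZ (cvg_cst a) x0) y0.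
by rewrite scaler0 addr0; apply.
Qed.

Section Hahn.
Variable R : realType.
Implicit Types (d : nat -> R) (x y : nat -> R[i]^o).

Definition cesaro_seq x : nat -> R[i]^o :=
  fun n => (\sum_(k < n.+1) x k) / n.+1%:R.

Definition hahn_weight d : Prop :=
  [/\ forall n, 1 <= d n, nondecreasing_seq d & d @ \oo --> +oo].

(* normc is the R-valued modulus; `|z| is the same number seen in R[i] *)
Definition hahn_sum d x : \bar R :=
  (\sum_(0 <= k <oo) (d k * normc (x k.+1 - x k))%:E)%E.

Definition hahn d : {pred nat -> R[i]^o} :=
  [pred x | `[< x @ \oo --> (0 : R[i]^o) /\ (hahn_sum d x < +oo)%E >]].

(* dP does not occur in the fields: it is a parameter of the type because the
   norm instance below depends on it *)
Record hahn_space d (dP : hahn_weight d) := HahnSpace {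
  hahn_seq :> nat -> R[i]^o;
  hahn_seqP : hahn_seq \in hahn d }.

Let normc_ge0 (z : R[i]) : 0 <= normc z.
Proof. by case: z => a b; exact: sqrtr_ge0. Qed.

Let normcD (a b : R[i]) : normc (a + b) <= normc a + normc b.
Proof. exact: le_normcD. Qed.

Let normcB (a b : R[i]) : normc (a - b) = normc (b - a).
Proof. by rewrite -normcN opprB. Qed.

Let normc_sum (F : nat -> R[i]) m n :
  normc (\sum_(m <= k < n) F k) <= \sum_(m <= k < n) normc (F k).
Proof.
elim/big_ind2 : _ => //; first by rewrite normc0.
by move=> a b c e h1 h2; apply: le_trans (normcD _ _) _; exact: lerD.
Qed.

Let normCE (z : R[i]) : `|z| = (normc z)%:C. Proof. by []. Qed.

Let normc_dist (a b : R[i]) : `|normc a - normc b| <= normc (a - b).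
Proof.
have := normcD (a - b) b; have := normcD (b - a) a.
rewrite !subrK [normc (b - a)]normcB => h1 h2.
by rewrite ler_norml lerNl opprB !lerBlDr h1 h2.
Qed.

Let ge_Re_normc (z : R[i]) : `|complex.Re z| <= normc z.
Proof. by rewrite -lecR; exact: normc_ge_Re. Qed.

Let ge_Im_normc (z : R[i]) : `|complex.Im z| <= normc z.
Proof.
case: z => a b /=; rewrite -[leLHS]sqrtr_sqr ler_sqrt ?lerDr ?sqr_ge0//.
by rewrite addr_ge0 ?sqr_ge0.
Qed.

Let le_normc (z : R[i]) : normc z <= `|complex.Re z| + `|complex.Im z|.
Proof.
case: z => a b /=; rewrite -[leRHS]ger0_norm ?addr_ge0// -sqrtr_sqr.
rewrite ler_sqrt ?sqr_ge0// sqrrD !real_normK ?num_real//.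
by rewrite lerD2r lerDl mulrn_wge0// mulr_ge0.
Qed.

Section Space.
Variables (d : nat -> R) (dP : hahn_weight d).

Let d_ge1 n : 1 <= d n. Proof. by case: dP. Qed.

Let d_ge0 n : 0 <= d n. Proof. exact: le_trans ler01 (d_ge1 n). Qed.

Let term_ge0 x k : (0 <= (d k * normc (x k.+1 - x k))%:E)%E.
Proof. by rewrite lee_fin mulr_ge0. Qed.

Lemma hahn_sum_ge0 x : (0 <= hahn_sum d x)%E.
Proof. by apply: nneseries_ge0 => *; exact: term_ge0. Qed.

Lemma hahn_sum_le x (M : R) :
  (forall n, \sum_(0 <= k < n) d k * normc (x k.+1 - x k) <= M) ->
  (hahn_sum d x <= M%:E)%E.
Proof.
move=> h; apply: lime_le; first by apply: is_cvg_nneseries => *; exact: term_ge0.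
by apply: nearW => n; rewrite sumEFin lee_fin.
Qed.

Lemma hahn_sum_ge x n :
  ((\sum_(0 <= k < n) d k * normc (x k.+1 - x k))%:E <= hahn_sum d x)%E.
Proof.
rewrite -sumEFin; apply: (@nneseries_lim_ge _ _ xpredT) => k _ _.
exact: term_ge0.
Qed.

Lemma hahn_sumD x y : (hahn_sum d (x + y)%R <= hahn_sum d x + hahn_sum d y)%E.
Proof.
rewrite /hahn_sum -nneseriesD; [|by move=> *; exact: term_ge0..].
apply: lee_nneseries => k *; first exact: term_ge0.
rewrite -EFinD lee_fin -mulrDr ler_wpM2l// !fctE opprD addrACA.
exact: normcD.
Qed.

Lemma hahn_sumZ (a : R[i]) x :
  hahn_sum d (a *: x)%R = ((normc a)%:E * hahn_sum d x)%E.
Proof.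
rewrite /hahn_sum -nneseriesZl; last by move=> *; exact: term_ge0.
apply: eq_eseriesr => k _; rewrite -EFinM !fctE -scalerBr normcM.
by rewrite mulrCA.
Qed.

Lemma hahn_sum0 : hahn_sum d 0 = 0%E.
Proof. by apply: eseries0 => k _ _; rewrite subrr normc0 mulr0. Qed.

Fact hahn_submod_closed : submod_closed (hahn d).
Proof.
split.
  apply/asboolP; split; first exact: cvg_cst.
  by rewrite hahn_sum0.
move=> a x y /asboolP[x0 xs] /asboolP[y0 ys].
apply/asboolP; split.
  exact: null_seqP.
apply: le_lt_trans (hahn_sumD _ _) _; rewrite hahn_sumZ.
apply: lte_add_pinfty => //.
by rewrite -(fineK (x := hahn_sum d x)) ?ltry// ge0_fin_numE// hahn_sum_ge0.
Qed.

HB.instance Definition _ :=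
  GRing.isSubmodClosed.Build _ _ (hahn d) hahn_submod_closed.

Local Notation H := (hahn_space dP).

HB.instance Definition _ := [isSub of H for @hahn_seq d dP].
HB.instance Definition _ := [Choice of H by <:].
HB.instance Definition _ := [SubChoice_isSubLmodule of H by <:].

Implicit Types u v : H.

Lemma hahn_cvg0 u : u n @[n --> \oo] --> (0 : R[i]^o).
Proof. by have /asboolP[] := hahn_seqP u. Qed.

Lemma hahn_sum_fin u : hahn_sum d u \is a fin_num.
Proof.
by rewrite ge0_fin_numE ?hahn_sum_ge0//; have /asboolP[] := hahn_seqP u.
Qed.

Definition hahn_norm u : R[i] := (fine (hahn_sum d u))%:C.

Lemma hahn_coord_le u n : normc (u n) <= fine (hahn_sum d u).
Proof.
have tel m : (n <= m)%N -> normc (u m - u n) <= fine (hahn_sum d u).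
  move=> nm; rewrite -telescope_sumr//; apply: le_trans (normc_sum _ _ _) _.
  rewrite -lee_fin fineK ?hahn_sum_fin//; apply: le_trans (hahn_sum_ge u m).
  rewrite lee_fin [leRHS](big_cat_nat (leq0n n) nm)/=; apply: ler_wpDl.
    by rewrite sumr_ge0// => k _; rewrite mulr_ge0.
  by apply: ler_sum => k _; rewrite ler_peMl.
apply/ler_addgt0Pr => e e0.
have eC : 0 < e%:C by rewrite ltcR.
have [m _ hm] := proj1 (@cvgr0Pnorm_lt _ _ _ _ _ _) (hahn_cvg0 u) _ eC.
have := hm (maxn m n) (leq_maxl _ _).
rewrite [`|_|]normCE ltcR => h2.
rewrite -[u n](subrK (u (maxn m n))).
apply: le_trans (normcD _ _) _; apply: lerD; last exact: ltW.
by rewrite normcB; apply: tel; exact: leq_maxr.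
Qed.

Fact hahn_normD u v : hahn_norm (u + v) <= hahn_norm u + hahn_norm v.
Proof.
rewrite /hahn_norm -rmorphD lecR -lee_fin EFinD !fineK ?hahn_sum_fin//.
exact: hahn_sumD.
Qed.

Fact hahn_normZ (a : R[i]) u : hahn_norm (a *: u) = `|a| * hahn_norm u.
Proof.
rewrite /hahn_norm normCE -rmorphM; congr (_%:C).
by rewrite [hahn_seq _]/(a *: hahn_seq u) hahn_sumZ fineM// hahn_sum_fin.
Qed.

Fact hahn_norm_eq0 u : hahn_norm u = 0 -> u = 0.
Proof.
move=> /(congr1 (@complex.Re R)) /= u0; apply/val_inj/funext => n /=.
apply: eq0_normc; apply/eqP; rewrite eq_le normc_ge0 andbT.
by rewrite -u0 hahn_coord_le.
Qed.

HB.instance Definition _ :=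
  Lmodule_isNormed.Build R[i] H hahn_normD hahn_normZ hahn_norm_eq0.

Lemma hahn_normE u : `|u| = (fine (hahn_sum d u))%:C. Proof. by []. Qed.

Section Complete.
Variable F : set_system H.
Hypotheses (FF : ProperFilter F) (Fc : cauchy F).

Let ball_near (e : R) : 0 < e ->
  exists v, \forall u \near F, fine (hahn_sum d (v - u)) < e.
Proof.
move=> e0; have eC : 0 < e%:C by rewrite ltcR.
have [v Fv] := proj1 (cauchyP F) Fc _ eC.
by exists v; apply: filterS Fv => u; rewrite -ball_normE /= hahn_normE ltcR.
Qed.

Let coord_cvg (p : R[i] -> R) (n : nat) :
  (forall a b, p (a - b) = p a - p b) -> (forall a, `|p a| <= normc a) ->
  cvg ((fun u : H => p (u n)) @ F).
Proof.
move=> pB ple; apply: cauchy_cvg; apply/cauchy_exP => e e0.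
have [v Fv] := ball_near e0; exists (p (v n)).
apply: filterS Fv => u ; rewrite -ball_normE /=; apply: le_lt_trans.
by rewrite -pB; apply: le_trans (ple _) _; exact: (hahn_coord_le (v - u)).
Qed.

Let lre n := lim ((fun u : H => complex.Re (u n)) @ F).
Let lim' n := lim ((fun u : H => complex.Im (u n)) @ F).
Let l : nat -> R[i]^o := fun n => Complex (lre n) (lim' n).

Let coord_near n (e : R) : 0 < e -> \forall u \near F, normc ((u : H) n - l n) < e.
Proof.
move=> e0; have e20 : 0 < e / 2 by rewrite divr_gt0.
have c1 : cvg ((fun u : H => complex.Re (u n)) @ F) by apply: coord_cvg => // -[? ?] [].
have c2 : cvg ((fun u : H => complex.Im (u n)) @ F) by apply: coord_cvg => // -[? ?] [].
have n1 := proj1 (@cvgrPdist_lt _ _ _ _ FF _ _) c1 _ e20.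
have n2 := proj1 (@cvgrPdist_lt _ _ _ _ FF _ _) c2 _ e20.
apply: filterS2 n1 n2 => u h1 h2; rewrite normcB.
apply: le_lt_trans (le_normc _) _; rewrite [ltRHS]splitr.
by apply: ltrD; [move: h1|move: h2]; rewrite /l /lre /lim'; case: (u n).
Qed.

Let term_cvg (v : H) k :
  (fun u : H =>
    d k * normc ((hahn_seq v - u) k.+1 - (hahn_seq v - u) k)) @ F -->
  d k * normc ((hahn_seq v - l) k.+1 - (hahn_seq v - l) k).
Proof.
apply: cvgMr; apply/cvgrPdist_lt => e e0.
have e20 : 0 < e / 2 by rewrite divr_gt0.
apply: filterS2 (coord_near k.+1 e20) (coord_near k e20) => u h1 h2.
apply: le_lt_trans (normc_dist _ _) _; rewrite [ltRHS]splitr.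
apply: le_lt_trans (ltrD h1 h2).
rewrite -[normc (u k - _)]normcN; apply: le_trans (normcD _ _).
rewrite !fctE le_eqVlt; apply/orP; left; apply/eqP; congr normc.
have ringE (a b p q p' q' : R[i]) :
  a - p - (b - q) - (a - p' - (b - q')) = p' - p + - (q' - q) by ring.
exact: ringE.
Qed.

Let limit_near (v : H) (e : R) :
  (\forall u \near F, fine (hahn_sum d (v - u)) < e) ->
  (hahn_sum d (hahn_seq v - l)%R <= e%:E)%E.
Proof.
move=> Fv; apply: hahn_sum_le => n.
apply: (cvgr_to_le (f := fun u : H => \sum_(0 <= k < n)
    d k * normc ((hahn_seq v - u) k.+1 - (hahn_seq v - u) k)) (F := F)).
  by apply: cvg_big => [|k _]; [exact: add_continuous|exact: term_cvg].
apply: filterS Fv => u /ltW; apply: le_trans.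
by rewrite -lee_fin fineK ?hahn_sum_fin//; exact: (hahn_sum_ge (v - u)).
Qed.

Let limit_hahn : l \in hahn d.
Proof.
apply/asboolP; split.
  apply: (proj2 (@cvgr0Pnorm_lt _ _ _ _ _ _)) => eps eps0.
  have epsE : (complex.Re eps)%:C = eps by rewrite RRe_real// gtr0_real.
  move: eps0; rewrite -epsE ltcR; set e := complex.Re eps => e0.
  have e40 : 0 < e / 4 by rewrite divr_gt0.
  have [v Fv] := ball_near e40.
  have e2C : 0 < (e / 2)%:C by rewrite ltcR divr_gt0.
  have := proj1 (@cvgr0Pnorm_lt _ _ _ _ eventually_filter _) (hahn_cvg0 v) _ e2C.
  apply: filterS => n; rewrite [`|_|]normCE ltcR => h1.
  rewrite [`|_|]normCE ltcR.
  have [u [h2 h3]] := filter_ex (filterI (coord_near n e40) Fv).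
  rewrite -[l n](subrK (v n)) [e]splitr.
  apply: le_lt_trans (normcD _ _) _; apply: ler_ltD h1.
  rewrite -[l n](subrK (u n)) -addrA [e / 2]splitr.
  apply: le_trans (normcD _ _) _; apply: lerD; rewrite normcB.
    by rewrite -mulrA -invfM -natrM ltW.
  rewrite -mulrA -invfM -natrM (le_trans _ (ltW h3))//.
  exact: (hahn_coord_le (v - u)).
have [v Fv] := ball_near ltr01.
have -> : l = -1 *: (hahn_seq v - l) + hahn_seq v.
  by rewrite scaleN1r opprB subrK.
apply: le_lt_trans (hahn_sumD _ _) _; apply: lte_add_pinfty; last first.
  by rewrite ltey_eq hahn_sum_fin.
rewrite hahn_sumZ; apply: le_lt_trans (ltry (normc (-1) * 1)).
by rewrite EFinM lee_wpmul2l ?lee_fin// limit_near.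
Qed.

Fact hahn_complete : cvg F.
Proof.
apply/cvg_ex; exists (HahnSpace dP limit_hahn).
apply: (proj2 (@cvgrPdist_lt _ _ _ _ _ _ _)) => eps eps0.
have epsE : (complex.Re eps)%:C = eps by rewrite RRe_real// gtr0_real.
move: eps0; rewrite -epsE ltcR; set e := complex.Re eps => e0.
have e20 : 0 < e / 2 by rewrite divr_gt0.
have [v Fv] := ball_near e20.
apply: filterS (Fv) => u h1.
rewrite -[_ - u](subrKA v); apply: le_lt_trans (ler_normD _ _) _.
rewrite [e]splitr rmorphD; apply: ler_ltD; last by rewrite hahn_normE ltcR.
rewrite distrC hahn_normE lecR -lee_fin fineK ?hahn_sum_fin//.
exact: limit_near.
Qed.

End Complete.

HB.instance Definition _ := Uniform_isComplete.Build H hahn_complete.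

End Space.
End Hahn.

(* Main.v *)
(* The differences of [y = C_1 x] are
   [y (k+1) - y k = (\sum_(j <= k) (j+1) (x (j+1) - x j)) / ((k+1) (k+2))], and
   the tails [\sum_(k >= j) d k / ((k+1) (k+2))] are at most [2 d j / (j+1)],
   whence [`|C_1| <= 2].  A nonzero solution of [C_1 x = l *: x] has [l] of the
   form [1/(m+1)] and nondecreasing moduli from the index [m] on, so it is not
   a null sequence.  The dual eigenvector at [z] has the coefficients
   [f n = \prod_(k <= n, 0 < k) (1 - 1/(z k))], of size [n ^ (- Re (1/z))], so
   it is summable for [Re (1/z) > 1] or [z = 1]; it annihilates the range of
   [z - C_1], and the boundary of the disc is covered by a perturbation of the
   resolvent.
   [C_1] maps the unit vectors [1_[0,N] / d N] to vectors of norm at least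
   [1/2] that tend to [0] coordinatewise, hence is not compact.  A limit of the
   ergodic means would be a fixed vector, hence [0], whereas the means fix the
   coordinate [0].  A supercyclic orbit [s = l *: C_1^n x] satisfies
   [`|x 0| `|s 0 - s 1| <= `|x 0 - x 1| `|s 0|], because [s 0] and [s 0 - s 1]
   are the dual eigenvectors at [1] and [1/2]; so it is not dense. *)

From HB Require Import structures.
Require Import Defs.
From mathcomp Require Import all_boot all_order all_algebra.
From mathcomp Require Import all_classical all_reals all_analysis.
From mathcomp Require Import complex ring lra.

Set Implicit Arguments.
Unset Strict Implicit.
Unset Printing Implicit Defensive.
Import Order.TTheory GRing.Theory Num.Theory.
Import numFieldNormedType.Exports.
Import Normc.

Local Open Scope classical_set_scope.
Local Open Scope ring_scope.
Local Open Scope complex_scope.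

(** * The logarithmic weight *)

(** The increment is [ln (1 + 1/(n+3))], at most [1/(n+3)]. The boundedness of [C_1] uses the
    logarithm only through this growth bound. *)
Lemma ln_succ_le (R : realType) (n : nat) :
  ln (n.+1 + 3)%:R - ln (n + 3)%:R <= n.+1%:R^-1 :> R.
Proof.
have n3 : 0 < (n + 3)%:R :> R by rewrite ltr0n addn_gt0 orbT.
rewrite -ln_div ?posrE ?ltr0n ?addn_gt0 ?orbT//.
have -> : (n.+1 + 3)%:R / (n + 3)%:R = 1 + (n + 3)%:R^-1 :> R.
  by rewrite addSn -natr1 mulrDl divff ?mul1r// lt0r_neq0.
apply: le_trans (le_ln1Dx _) _.
  by apply: (@lt_trans _ _ 0) => //; rewrite ?ltrN10// invr_gt0.
by rewrite lef_pV2 ?posrE// ?ltr0n// ler_nat addnS ltnS leq_addr.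
Qed.

Lemma ln3_ge1 (R : realType) : 1 <= ln 3 :> R.
Proof.
rewrite -[leLHS]expRK ler_ln ?posrE ?expR_gt0//.
(* [exp(1/6) <= 6/5] because [exp(-1/6) >= 5/6], and [(6/5)^6 < 3] *)
have e6 : expR 6^-1 <= 6 / 5 :> R.
  have := expR_ge1Dx (- 6^-1 : R); rewrite expRN.
  have e0 := expR_gt0 (6^-1 : R).
  rewrite -[leRHS]div1r ler_pdivlMr// => h.
  rewrite -(@ler_pM2r _ (1 - 6^-1)); last lra.
  by rewrite mulrC; apply: le_trans h _; lra.
have -> : expR 1 = expR 6^-1 ^+ 6 :> R.
  by rewrite -expRM_natl divff// pnatr_eq0.
apply: (@le_trans _ _ ((6 / 5) ^+ 6)); last lra.
by apply: lerXn2r; rewrite ?nnegrE ?expR_ge0//; lra.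
Qed.

Lemma ln_hahn_weight (R : realType) :
  hahn_weight (fun n => ln (n + 3)%:R : R).
Proof.
have mono : nondecreasing_seq (fun n => ln (n + 3)%:R : R).
  by move=> m n mn; rewrite ler_ln ?posrE ?ltr0n ?addn_gt0 ?orbT// ler_nat leq_add2r.
split => // [n|]; first exact: le_trans (ln3_ge1 R) (mono 0%N n (leq0n n)).
apply/cvgryPge => A; exists (Num.truncn (expR A)).+1 => // n /= An.
rewrite -[leLHS]expRK ler_ln ?posrE ?expR_gt0 ?ltr0n ?addn_gt0 ?orbT//.
apply: ltW; apply: lt_le_trans (truncnS_gt _) _; rewrite ler_nat.
by rewrite (leq_trans An)// leq_addr.
Qed.

(** * Complex sequences *)

Section Complex.
Variable R : realType.

Lemma normc_ge0 (z : R[i]) : 0 <= normc z.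
Proof. by case: z => a b; exact: sqrtr_ge0. Qed.

Lemma normcB (a b : R[i]) : normc (a - b) = normc (b - a).
Proof. by rewrite -normcN opprB. Qed.

Lemma normcX (z : R[i]) n : normc (z ^+ n) = normc z ^+ n.
Proof. by elim: n => [|n ih]; rewrite ?normc1// !exprS normcM ih. Qed.

Lemma normc_nat n : normc (n%:R : R[i]) = n%:R.
Proof. by rewrite normcMn normc1. Qed.

Lemma normc_real (a : R) : normc a%:C = `|a|.
Proof. by rewrite /= expr0n addr0 sqrtr_sqr. Qed.

Lemma normc_sum (F : nat -> R[i]) m n :
  normc (\sum_(m <= k < n) F k) <= \sum_(m <= k < n) normc (F k).
Proof.
elim/big_ind2 : _ => [|a b c e h1 h2|//]; first by rewrite normc0.
by apply: le_trans (le_normcD _ _) _; exact: lerD.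
Qed.

Lemma normc_Re (z : R[i]) : `|complex.Re z| <= normc z.
Proof. by rewrite -lecR; exact: normc_ge_Re. Qed.

Lemma normc_Im (z : R[i]) : `|complex.Im z| <= normc z.
Proof.
case: z => a b /=; rewrite -[leLHS]sqrtr_sqr ler_sqrt ?lerDr ?sqr_ge0//.
by rewrite addr_ge0 ?sqr_ge0.
Qed.

Lemma normc_le_ReIm (z : R[i]) :
  normc z <= `|complex.Re z| + `|complex.Im z|.
Proof.
case: z => a b /=; rewrite -[leRHS]ger0_norm ?addr_ge0// -sqrtr_sqr.
rewrite ler_sqrt ?sqr_ge0// sqrrD !real_normK ?num_real//.
by rewrite lerD2r lerDl mulrn_wge0// mulr_ge0.
Qed.

(** Norms here take values in [R[i]], so the radii in the definition of convergence are complex;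
    being positive, they are real. *)
Lemma cvgC_distP (V : normedModType R[i]) T (F : set_system T) {FF : Filter F}
    (u : T -> V) (l : V) :
  u @ F --> l <->
  forall e : R, 0 < e -> \forall n \near F, `|l - u n| < e%:C.
Proof.
split => [/cvgrPdist_lt ul e e0|ul]; first by apply: ul; rewrite ltcR.
apply/cvgrPdist_lt => eps eps0.
have epsE : (complex.Re eps)%:C = eps by rewrite RRe_real// gtr0_real.
by rewrite -epsE; apply: ul; rewrite -ltcR epsE.
Qed.

Lemma cvgC_normc T (F : set_system T) {FF : Filter F} (u : T -> R[i]^o)
    (l : R[i]^o) :
  u @ F --> l <-> (fun t => normc (u t - l)) @ F --> (0 : R).
Proof.
split => [/cvgC_distP ul|/cvgr0Pnorm_lt ul].
  apply/cvgr0Pnorm_lt => e /ul; apply: filterS => t.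
  by rewrite [`|_|]/((normc _)%:C) ltcR normcB (ger0_norm (normc_ge0 _)).
apply/cvgC_distP => e /ul; apply: filterS => t.
by rewrite [`|l - _|]/((normc _)%:C) ltcR normcB (ger0_norm (normc_ge0 _)).
Qed.

Lemma cvg_normc_le (u : nat -> R[i]^o) (l : R[i]^o) (M : R) :
  u @ \oo --> l -> (forall n, normc (u n) <= M) -> normc l <= M.
Proof.
move=> /cvgC_distP ul uM; apply/ler_addgt0Pr => e /ul /filter_ex[n].
rewrite [`|_|]/((normc _)%:C) ltcR => h.
rewrite -[l](subrK (u n)) addrC; apply: le_trans (le_normcD _ _) _.
by apply: lerD; rewrite ?uM// ltW.
Qed.

(* [R[i]] has no complete normed module instance, hence the detour through
   real and imaginary parts. *)
Lemma cvg_series_normc (a : nat -> R[i]^o) (M : R) :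
  (forall n, \sum_(0 <= k < n) normc (a k) <= M) -> cvgn (series a).
Proof.
move=> aM.
have part (p : R[i] -> R) : (forall z, `|p z| <= normc z) ->
    cvgn (series (p \o a)).
  move=> pa; apply: normed_cvg; apply: nondecreasing_is_cvgn.
    by apply: nondecreasing_series => n _ _ /=.
  exists M => _ [n _ <-]; apply: le_trans (aM n).
  by rewrite /series /=; apply: ler_sum.
have cR := part _ normc_Re; have cI := part _ normc_Im.
apply/cvg_ex; exists (Complex (limn (series (@complex.Re R \o a)))
                      (limn (series (@complex.Im R \o a)))).
apply/cvgC_distP => e e0; have e2 : 0 < e / 2 by rewrite divr_gt0.
move/cvgrPdist_lt : cR => /(_ _ e2); move/cvgrPdist_lt : cI => /(_ _ e2).
apply: filterS2 => n hI hR.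
rewrite [`|_|]/((normc _)%:C) ltcR; apply: le_lt_trans (normc_le_ReIm _) _.
rewrite [ltRHS]splitr ltrD//.
  move: hR; rewrite /series/= -(raddf_sum (@complex.Re R))/=.
  by case: (\sum_(0 <= k < n) a k).
move: hI; rewrite /series/= -(raddf_sum (@complex.Im R))/=.
by case: (\sum_(0 <= k < n) a k).
Qed.

End Complex.

(** * Bounded operators over the complex numbers *)

Section BoundedOps.
Variables (R : realType) (X Y : normedModType R[i]).

Lemma bounded_op_predP (f : X -> Y) (M : R) :
  linear f -> (forall x, `|f x| <= M%:C * `|x|) -> f \in @bounded_op_pred _ X Y.
Proof.
move=> lf fM; apply/asboolP; split => //.
pose F : {linear X -> Y} := HB.pack f (GRing.isLinear.Build R[i] X Y *:%R f lf).
apply: (proj1 (linear_bounded_continuous F)); apply: (proj2 (linear_boundedP F)).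
exists M%:C; split => [|r /ltW Mr x]; first by have := num_real M; rewrite !realE -!lecR.
by apply: le_trans (fM x) _; exact: ler_wpM2r.
Qed.

Lemma bounded_op_bound (T : bounded_op X Y) :
  exists2 M : R, 0 < M & forall x, `|T x| <= M%:C * `|x|.
Proof.
have /asboolP[lT cT] := op_funP T.
pose F : {linear X -> Y} := HB.pack (op_fun T) (GRing.isLinear.Build R[i] X Y *:%R T lT).
have /linear_boundedP[r [rreal rb]] :
    bounded_near F (nbhs 0).
  by apply: (proj2 (linear_bounded_continuous F)); exact: cT.
(* Every constant strictly above [r] is a bound; adding 1 gives such a constant that is also
   positive. *)
exists (`|complex.Re r| + 1); first by rewrite ltr_wpDl.
apply: rb; rewrite -(RRe_real rreal) ltcR.
by apply: le_lt_trans (ler_norm _) _; rewrite ltrDl.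
Qed.

End BoundedOps.

(** * Cesàro means *)

Section CesaroSeq.
Variable R : realType.
Implicit Types x : nat -> R[i]^o.

(** Abel summation. At [n.+1] the right side is the numerator of the difference of two consecutive
    means. *)
Lemma sum_weighted_diff x n :
  \sum_(0 <= j < n) j.+1%:R * (x j.+1 - x j) =
  n%:R * x n - \sum_(0 <= j < n) x j :> R[i].
Proof.
elim: n => [|n ih]; first by rewrite !big_geq// mul0r subrr.
rewrite !big_nat_recr//= ih -[n.+1]addn1 natrD /=; ring.
Qed.

Lemma cesaro_diff x n :
  cesaro_seq x n.+1 - cesaro_seq x n =
  (\sum_(0 <= j < n.+1) j.+1%:R * (x j.+1 - x j)) / (n.+1%:R * n.+2%:R) :> R[i].
Proof.
rewrite sum_weighted_diff /cesaro_seq -!(big_mkord xpredT x).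
rewrite [\sum_(0 <= _ < n.+2) _]big_nat_recr//=.
have n1 : n.+1%:R != 0 :> R[i] by rewrite pnatr_eq0.
have n2 : n.+2%:R != 0 :> R[i] by rewrite pnatr_eq0.
have e : n.+2%:R = n.+1%:R + 1 :> R[i] by rewrite natr1.
move: n2; rewrite e => n2; field; exact/andP.
Qed.

Lemma cesaro_seq_linear (a : R[i]) x y :
  cesaro_seq (a *: x + y) = a *: cesaro_seq x + cesaro_seq y.
Proof.
apply/funext => n; rewrite /cesaro_seq !fctE /= big_split/= -scaler_sumr.
by rewrite mulrDl scalerAl.
Qed.

Lemma cesaro_cvg0 x : x @ \oo --> (0 : R[i]^o) ->
  cesaro_seq x @ \oo --> (0 : R[i]^o).
Proof.
move=> /cvgC_normc; under eq_fun do rewrite subr0.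
move=> /cesaro x0; apply/cvgC_normc; under eq_fun do rewrite subr0.
apply: squeeze_cvgr (cvg_cst 0) x0; apply: nearW => n.
rewrite normc_ge0 /= /cesaro_seq normcM normcV normc_nat mulrC.
rewrite /arithmetic_mean /series /= -(big_mkord xpredT x).
by rewrite ler_wpM2l ?invr_ge0// normc_sum.
Qed.

Lemma cesaro_eigen_null x (l : R[i]) : x @ \oo --> (0 : R[i]^o) ->
  cesaro_seq x = l *: x -> x = 0.
Proof.
move=> x0 xl.
have S n : \sum_(0 <= j < n.+1) x j = n.+1%:R * l * x n.
  have /(congr1 ( *%R n.+1%:R)) := congr1 (fun f => f n : R[i]) xl.
  rewrite /cesaro_seq -(big_mkord xpredT x) mulrC mulfVK ?pnatr_eq0// => ->.
  by rewrite -mulrA.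
apply: contrapT => /eqP xn0.
have [m xm xlt] : exists2 m, x m != 0 & forall j, (j < m)%N -> x j = 0.
  have exm : exists n, x n != 0.
    apply: contrapT => h; move/eqP: xn0; apply; apply/funext => n.
    by apply: contrapT => /eqP xn; apply: h; exists n.
  exists (ex_minn exm); case: ex_minnP => // m _ mmin j jm.
  by apply: contrapT => /eqP/mmin; rewrite leqNgt jm.
have ml : m.+1%:R * l = 1.
  apply: (mulIf xm); rewrite -S mul1r big_nat_recr//= big_nat big1 ?add0r//.
(* Subtract two consecutive instances of [S] and multiply by [m.+1], the inverse of [l]. *)
have rec n : n.+1%:R * x (m + n).+1 = (m + n).+1%:R * x (m + n)%N.
  have := S (m + n).+1; rewrite big_nat_recr//= S => /(canRL (addrK _)) h.
  have alg (p q r u v : R[i]) : p * l = 1 -> r * l * u = (p + q) * l * v - v ->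
      q * v = r * u.
    move=> pl ru; rewrite -[RHS]mul1r -pl.
    have -> : p * l * (r * u) = p * (r * l * u) by ring.
    have -> : p * (r * l * u) = (p * l) * (p + q) * v - p * v by rewrite ru; ring.
    by rewrite pl; ring.
  apply: (alg m.+1%:R) => //; rewrite h; congr (_ * _ * _ - _).
  by rewrite -natrD addSn addnS.
have big n : normc (x m) <= normc (x (m + n)%N).
  elim: n => [|n ih]; first by rewrite addn0.
  apply: le_trans ih _; have /(congr1 (@normc R)) := rec n.
  rewrite !normcM !normc_nat addnS => h.
  rewrite -(@ler_pM2l _ n.+1%:R)// h ler_wpM2r ?normc_ge0// ler_nat.
  by rewrite ltnS leq_addl.
have xm0 : 0 < normc (x m).
  by rewrite lt_neqAle normc_ge0 andbT eq_sym; apply: contra xm => /eqP/eq0_normc ->.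
(* Past some [N] the moduli would be below that of [x m], against [big] at [m + N]. *)
move/cvgC_distP : x0 => /(_ _ xm0)[N _] /(_ _ (leq_addl m N)).
by rewrite /= sub0r normrN [`|_|]/((normc _)%:C) ltcR ltNge big.
Qed.

Section Bound.
Variable d : nat -> R.
Hypothesis d_ge1 : forall n, 1 <= d n.
Hypothesis d_diff : forall n, d n.+1 - d n <= n.+1%:R^-1.

(* Summation by parts with [G n = (d n + 1) / n.+1], which satisfies
   [d n / (n.+1 * n.+2) <= G n - G n.+1]: it controls the tails of
   [\sum_k d k / (k.+1 * k.+2)]. *)
Lemma cesaro_hahn_partial x n :
  \sum_(0 <= k < n) d k * normc (cesaro_seq x k.+1 - cesaro_seq x k)
  <= 2 * \sum_(0 <= k < n) d k * normc (x k.+1 - x k).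
Proof.
pose a k := normc (x k.+1 - x k); have a0 k : 0 <= a k by exact: normc_ge0.
pose A n := \sum_(0 <= j < n) j.+1%:R * a j.
have A0 m : 0 <= A m by apply: sumr_ge0 => j _; exact: mulr_ge0.
(* The term [G n * A n] pays for the increments of index at least [n] and makes the induction close;
   the factor 2 comes from [d k + 1 <= 2 * d k]. *)
suff h : \sum_(0 <= k < n) d k * normc (cesaro_seq x k.+1 - cesaro_seq x k)
    + (d n + 1) / n.+1%:R * A n <= \sum_(0 <= k < n) (d k + 1) * a k.
  have dn : 0 <= d n by exact: le_trans ler01 _.
  apply: (@le_trans _ _ (\sum_(0 <= k < n) (d k + 1) * a k)).
    apply: le_trans h; rewrite lerDl mulr_ge0// divr_ge0// addr_ge0//.
  rewrite mulr_sumr; apply: ler_sum => k _; rewrite mulrA ler_wpM2r//.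
  by have := d_ge1 k; lra.
elim: n => [|n ih]; first by rewrite /A !big_geq// mulr0 addr0.
rewrite !big_nat_recr//=.
have dA : normc (cesaro_seq x n.+1 - cesaro_seq x n) <=
    A n.+1 / (n.+1%:R * n.+2%:R).
  rewrite cesaro_diff normcM normcV normcM !normc_nat.
  rewrite ler_wpM2r// ?invr_ge0//; apply: le_trans (normc_sum _ _ _) _.
  by apply: ler_sum => j _; rewrite normcM normc_nat.
have AE : A n.+1 = A n + n.+1%:R * a n by rewrite /A big_nat_recr.
have step : d n / (n.+1%:R * n.+2%:R) + (d n.+1 + 1) / n.+2%:R
    <= (d n + 1) / n.+1%:R.
  have := d_diff n; have e : n.+2%:R = n.+1%:R + 1 :> R by rewrite natr1.
  rewrite e; have q0 : 0 < n.+1%:R :> R by [].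
  move: q0; move: (n.+1%:R : R) => q q0.
  rewrite -[leRHS]div1r ler_pdivlMr// => h.
  rewrite -subr_ge0; have q1 : 0 < q + 1 by rewrite addr_gt0.
  have -> : (d n + 1) / q - (d n / (q * (q + 1)) + (d n.+1 + 1) / (q + 1)) =
      (1 - (d n.+1 - d n) * q) / (q * (q + 1)).
    by field; rewrite !lt0r_neq0.
  by rewrite divr_ge0 ?subr_ge0// mulr_ge0// ltW.
apply: (@le_trans _ _ (\sum_(0 <= k < n) d k * normc (cesaro_seq x k.+1 - cesaro_seq x k)
   + (d n + 1) / n.+1%:R * A n.+1)).
  rewrite -addrA lerD2l; apply: le_trans (ler_wpM2r (A0 _) step).
  rewrite [leRHS]mulrDl lerD2r -mulrA [_^-1 * _]mulrC ler_wpM2l//.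
  exact: le_trans ler01 _.
(* The growth of [A] contributes [G n * n.+1 * a n = (d n + 1) * a n], exactly the new term on the
   right. *)
rewrite AE mulrDr addrA; apply: lerD => //.
by rewrite mulrA divfK ?pnatr_eq0.
Qed.

End Bound.
End CesaroSeq.

(** * Linearity of bounded operators, and density in terms of the norm *)

Section BoundedOpTheory.
Variables (K : numFieldType) (X Y : normedModType K) (T : bounded_op X Y).

Lemma bounded_opD u v : T (u + v) = T u + T v.
Proof.
by have /asboolP[lT _] := op_funP T; rewrite -[u in LHS]scale1r lT scale1r.
Qed.

Lemma bounded_op0 : T 0 = 0.
Proof. by apply: (addrI (T 0)); rewrite -bounded_opD !addr0. Qed.

Lemma bounded_opZ a u : T (a *: u) = a *: T u.
Proof.
by have /asboolP[lT _] := op_funP T; rewrite -[X in T X]addr0 lT bounded_op0 addr0.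
Qed.

Lemma bounded_opB u v : T (u - v) = T u - T v.
Proof. by rewrite -scaleN1r bounded_opD bounded_opZ scaleN1r. Qed.

End BoundedOpTheory.

Lemma dense_normC (R : realType) (V : normedModType R[i]) (S : set V) :
  dense S -> forall (v : V) (e : R), 0 < e -> exists2 s, S s & `|v - s| < e%:C.
Proof.
move=> dS v e e0; pose O := interior (ball v e%:C).
have [|s [/interior_subset vs Ss]] := dS O _ (open_interior _).
  by exists v; apply: nbhsx_ballx; rewrite ltcR.
by exists s => //; move: vs; rewrite -ball_normE.
Qed.

(** * The Cesàro operator on Hahn spaces *)

Section HahnSpace.
Variables (R : realType) (d : nat -> R) (dP : hahn_weight d).
Local Notation H := (hahn_space dP).

Lemma hahn_weight_ge1 n : 1 <= d n. Proof. by case: dP. Qed.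

Lemma hahn_weight_gt0 n : 0 < d n.
Proof. exact: lt_le_trans ltr01 (hahn_weight_ge1 n). Qed.

Lemma hahn_partial_le (u : H) n :
  \sum_(0 <= k < n) d k * normc (u k.+1 - u k) <= fine (hahn_sum d u).
Proof. by rewrite -lee_fin fineK ?hahn_sum_fin//; exact: hahn_sum_ge. Qed.

Lemma fine_hahn_sum_le (u : H) (M : R) :
  (forall n, \sum_(0 <= k < n) d k * normc (u k.+1 - u k) <= M) ->
  fine (hahn_sum d u) <= M.
Proof.
by move=> h; rewrite -lee_fin fineK ?hahn_sum_fin//; exact: hahn_sum_le.
Qed.

Lemma hahnP (x : nat -> R[i]^o) (M : R) : x @ \oo --> (0 : R[i]^o) ->
  (forall n, \sum_(0 <= k < n) d k * normc (x k.+1 - x k) <= M) ->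
  x \in hahn d.
Proof.
move=> x0 xM; apply/asboolP; split => //.
by apply: le_lt_trans (ltry M); exact: hahn_sum_le.
Qed.

Lemma hahn_coord_dist (u v : H) (e : R) n :
  `|u - v| < e%:C -> normc (u n - v n) < e.
Proof.
by rewrite hahn_normE ltcR; apply: le_lt_trans; exact: (hahn_coord_le (u - v)).
Qed.

Lemma hahn_ext (u v : H) : (forall n, u n = v n) -> u = v.
Proof. by move=> uv; apply/val_inj/funext. Qed.

Lemma hahn_seqD (u v : H) n : (u + v : H) n = u n + v n :> R[i].
Proof. by []. Qed.

Lemma hahn_seqZ (a : R[i]) (u : H) n : (a *: u : H) n = a * u n :> R[i].
Proof. by []. Qed.

(** The indicator of [[0, N]] has the single nonzero increment -1, at [N], so its norm is [d N]. *)
Definition step_seq N : nat -> R[i]^o := fun n => (n <= N)%:R.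

Lemma step_seq_diff N k :
  step_seq N k.+1 - step_seq N k = if k == N then -1 else 0 :> R[i].
Proof.
rewrite /step_seq ltn_neqAle; case: (eqVneq k N) => [->|_] /=.
  by rewrite leqnn sub0r.
by rewrite subrr.
Qed.

Lemma step_seq_partial N n :
  \sum_(0 <= k < n) d k * normc (step_seq N k.+1 - step_seq N k) <= d N.
Proof.
under eq_bigr => k _.
  rewrite step_seq_diff (fun_if (@normc R)) normc0 normcN normc1.
  rewrite (fun_if ( *%R (d k))) mulr0 mulr1. over.
rewrite -big_mkcond big_nat1_eq /=; case: ifP => // _.
exact: ltW (hahn_weight_gt0 N).
Qed.

Lemma step_seq_hahn N : step_seq N \in hahn d.
Proof.
apply: hahnP (step_seq_partial N).
apply: cvg_near_cst; exists N.+1 => // n /= Nn.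
by rewrite /step_seq leqNgt Nn.
Qed.

Definition step N : H := HahnSpace dP (step_seq_hahn N).

End HahnSpace.

(** * Existence of the operator; ergodicity, supercyclicity and compactness *)

Section CesaroOp.
Variables (R : realType) (d : nat -> R) (dP : hahn_weight d).
Local Notation H := (hahn_space dP).

Section Existence.
Hypothesis d_diff : forall n, d n.+1 - d n <= n.+1%:R^-1.

Lemma cesaro_hahn (x : nat -> R[i]^o) : x \in hahn d -> cesaro_seq x \in hahn d.
Proof.
move=> xd; pose u := HahnSpace dP xd; have /asboolP[x0 _] := xd.
apply: (@hahnP _ _ dP _ (2 * fine (hahn_sum d u))); first exact: cesaro_cvg0.
move=> n; apply: le_trans (cesaro_hahn_partial (hahn_weight_ge1 dP) d_diff x n) _.
by rewrite ler_pM2l//; exact: (hahn_partial_le u).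
Qed.

Lemma cesaro_op_exists :
  exists C : bounded_op H H, forall x : H, hahn_seq (C x) = cesaro_seq x.
Proof.
pose C (u : H) : H := HahnSpace dP (cesaro_hahn (hahn_seqP u)).
suff CP : C \in @bounded_op_pred _ H H by exists (BoundedOp CP).
apply: (@bounded_op_predP _ _ _ _ 2) => [a u v|u].
  by apply/val_inj; exact: cesaro_seq_linear.
rewrite !hahn_normE -rmorphM lecR; apply: fine_hahn_sum_le => n.
apply: le_trans (cesaro_hahn_partial (hahn_weight_ge1 dP) d_diff u n) _.
by rewrite ler_pM2l//; exact: hahn_partial_le.
Qed.

End Existence.

Variable C : bounded_op H H.
Hypothesis CE : forall x : H, hahn_seq (C x) = cesaro_seq (hahn_seq x).

Lemma cesaro_eigen0 (x : H) (l : R[i]) : C x = l *: x -> x = 0.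
Proof.
move=> Cx; apply/val_inj; apply: cesaro_eigen_null (hahn_cvg0 x) _.
by rewrite -CE Cx.
Qed.

Lemma cesaro_iter0 n (x : H) : iter n C x 0%N = x 0%N.
Proof.
by elim: n => //= n <-; rewrite CE /cesaro_seq big_ord1 divr1.
Qed.

(** The first two means are [x 0] and [(x 0 + x 1) / 2], so each application halves the
    difference. *)
Lemma cesaro_iter_diff n (x : H) :
  iter n C x 0%N - iter n C x 1%N = 2^-1 ^+ n * (x 0%N - x 1%N) :> R[i].
Proof.
elim: n => [|n ih] /=; first by rewrite mul1r.
rewrite exprS -mulrA -ih CE /cesaro_seq !big_ord_recr !big_ord0/=.
by field.
Qed.

Lemma cesaro_not_mean_ergodic : ~ mean_ergodic C.
Proof.
move=> [P hP]; pose x := step dP 0; pose z := P x.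
pose A n := ergodic_mean C n x.
(* The shift drops [A 0], which is 0 by convention. *)
have AS : A n.+1 @[n --> \oo] --> z by move: (hP x); rewrite -(cvg_shiftS A).
have ASS : A n.+2 @[n --> \oo] --> z.
  by move: AS; rewrite -(cvg_shiftS (fun n => A n.+1)).
have Csum n : C (\sum_(1 <= m < n.+1) iter m C x) =
    \sum_(1 <= m < n.+2) iter m C x - C x.
  elim: n => [|n ih]; first by rewrite big_geq// big_nat1 subrr bounded_op0.
  by rewrite big_nat_recr//= bounded_opD ih [in RHS]big_nat_recr//= addrAC.
(* Comparing with [A n.+2] rather than [A n.+1] leaves a convergent sequence times a null factor. *)
have CA n : C (A n.+1) - A n.+2 = n.+1%:R^-1 *: (A n.+2 - C x).
  rewrite /A /ergodic_mean bounded_opZ Csum.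
  set S := \sum_(1 <= m < n.+3) _.
  rewrite -{1}[S](@scalerKV _ _ n.+2%:R) ?pnatr_eq0//.
  set B := n.+2%:R^-1 *: S.
  have -> : n.+2%:R *: B = n.+1%:R *: B + B by rewrite -[n.+2%:R]natr1 scalerDl scale1r.
  rewrite -[X in _ *: X]addrA scalerDr scalerA mulVf ?pnatr_eq0// scale1r.
  by rewrite addrAC subrr add0r.
have CA0 : C (A n.+1) - A n.+2 @[n --> \oo] --> (0 : H).
  rewrite (_ : (fun n => _) = fun n => n.+1%:R^-1 *: (A n.+2 - C x)); last first.
    by apply/funext => n; exact: CA.
  rewrite -[X in _ --> X](scale0r (z - C x)).
  apply: cvgZ; last exact: cvgB ASS (cvg_cst _).
  apply/cvgC_normc; under eq_fun do rewrite subr0 normcV normc_nat.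
  exact: cvg_harmonic.
have CAz : C (A n.+1) - A n.+2 @[n --> \oo] --> C z - z.
  by apply: cvgB => //; apply: continuous_cvg => //; exact: op_continuous.
have Cz : C z = z.
  by apply/eqP; rewrite -subr_eq0; apply/eqP; exact: cvg_unique CAz CA0.
have z0 : z = 0 by apply: (@cesaro_eigen0 z 1); rewrite scale1r.
have A1 n : A n.+1 0%N = 1.
  have it m : iter m C x 0%N = 1 by rewrite cesaro_iter0.
  have sumE k : (\sum_(1 <= m < k.+1) iter m C x : H) 0%N = k%:R.
    elim: k => [|k ih]; first by rewrite big_geq.
    by rewrite big_nat_recr// hahn_seqD ih it natr1.
  by rewrite /A /ergodic_mean hahn_seqZ sumE mulVf// pnatr_eq0.
move/cvgC_distP : AS => /(_ 1 ltr01)/filter_ex[n].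
by move/(@hahn_coord_dist _ _ _ _ _ _ 0%N); rewrite A1 z0 sub0r normcN normc1 ltxx.
Qed.

Lemma cesaro_not_supercyclic : ~ supercyclic C.
Proof.
move=> [x /dense_normC dx].
have s0 (s : H) l n : s = l *: iter n C x -> s 0%N = l * x 0%N.
  by move=> ->; rewrite hahn_seqZ cesaro_iter0.
(* If [x 0 = 0], the whole orbit vanishes at coordinate 0 and stays at distance at least 1 from
   [step dP 0]. *)
have [x00|x0] := eqVneq (x 0%N) 0.
  have [s [l [n /s0 sE]]] := dx (step dP 0) 1 ltr01.
  by move/(@hahn_coord_dist _ _ _ _ _ _ 0%N); rewrite sE x00 mulr0 subr0 normc1 ltxx.
pose p := normc (x 0%N); pose q := normc (x 0%N - x 1%N).
have p0 : 0 < p.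
  by rewrite lt_neqAle normc_ge0 andbT eq_sym; apply: contra x0 => /eqP/eq0_normc ->.
have q0 : 0 <= q by exact: normc_ge0.
(* This radius [e] solves [p * (1 - 2 * e) = q * e]. An orbit point [s] closer than [e] to the unit
   vector at coordinate 1 has [s 0] smaller than [e] and [s 0 - s 1] larger than [1 - 2 * e] in
   modulus, against [le1]. *)
have e0 : 0 < p / (2 * p + q) by rewrite divr_gt0// ltr_wpDr// mulr_gt0.
have [s [l [n sE]] vs] := dx (step dP 1 - step dP 0) _ e0.
have h0 := hahn_coord_dist 0 vs; have h1 := hahn_coord_dist 1 vs.
have le1 : p * normc (s 0%N - s 1%N) <= q * normc (s 0%N).
  rewrite [in leRHS](s0 _ _ _ sE) sE !hahn_seqZ.
  rewrite -mulrBr cesaro_iter_diff !normcM normcX normcV normc_nat -/p -/q.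
  have -> : p * (normc l * (2^-1 ^+ n * q)) = 2^-1 ^+ n * (q * (normc l * p)) by ring.
  rewrite ler_piMl// ?mulr_ge0// ?normc_ge0//.
  by rewrite exprn_ile1// invf_le1// ler1n.
move: h0 h1; rewrite -[X in X - s 0%N]/(1 - 1 : R[i]) -[X in X - s 1%N]/(1 - 0 : R[i]).
rewrite subrr sub0r subr0 normcN => h0 h1.
have h2 : 1 <= normc (s 0%N - s 1%N) + normc (s 0%N) + normc (1 - s 1%N).
  have E : 1 = - (s 0%N - s 1%N) + s 0%N + (1 - s 1%N) :> R[i] by ring.
  rewrite -[leLHS](normc1 R) [in leLHS]E.
  apply: le_trans (le_normcD _ _) _; rewrite lerD2r.
  by apply: le_trans (le_normcD _ _) _; rewrite normcN.
move: le1 h0 h1 h2 e0; set e := p / (2 * p + q).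
have ep : e * (2 * p + q) = p by rewrite divfK// lt0r_neq0// ltr_wpDr// mulr_gt0.
move: ep; move: (normc (s 0%N - s 1%N)) (normc (s 0%N)) (normc (1 - s 1%N)).
move: e => e a b c ep h h0 h1 h2 e0.
have pa : p * (1 - 2 * e) <= p * a by rewrite ler_pM2l//; lra.
have : q * b <= q * e by apply: ler_wpM2l => //; exact: ltW.
have : p * (1 - 2 * e) < p * a by rewrite ltr_pM2l//; lra.
lra.
Qed.

Lemma cesaro_not_compact : ~ compact_op C.
Proof.
move=> [U UC [cU _]].
pose w N := C (((d N)^-1)%:C *: step dP N).
have d0 N : 0 < d N by exact: hahn_weight_gt0.
have di N : 0 <= (d N)^-1 by rewrite invr_ge0 ltW.
have Uw N : U (w N).
  apply: UC; exists (((d N)^-1)%:C *: step dP N) => //=.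
  rewrite normrZ hahn_normE ger0_norm ?lecR//.
  rewrite -rmorphM -[leRHS]/(1%:C) lecR ler_pdivrMl// mulr1.
  exact/fine_hahn_sum_le/step_seq_partial.
have wU : (w @ \oo) U by exists 0%N => // N _; exact: Uw.
have [v [_ vw]] := cU (w @ \oo) _ wU.
(* [v] is a cluster point of [w]: the approximating index can be taken in any cofinite set. *)
have clu e (S : set nat) : 0 < e -> (\forall n \near \oo, S n) ->
    exists2 N, S N & `|v - w N| < e%:C.
  move=> e0 Sn; have eC : 0 < e%:C by rewrite ltcR.
  have wS : (w @ \oo) (w @` S) by apply: filterS Sn => n Sn; exists n.
  have [_ [[N SN <-] vN]] := vw _ _ wS (nbhsx_ballx v _ eC).
  by exists N => //; move: vN; rewrite -ball_normE.
have wk N k : normc (w N k) <= (d N)^-1.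
  rewrite CE /cesaro_seq -(big_mkord xpredT (_ *: _ : H)) normcM normcV normc_nat.
  rewrite ler_pdivrMr//; apply: le_trans (normc_sum _ _ _) _.
  rewrite mulr_natr -[k.+1 in leRHS]subn0 -sumr_const_nat; apply: ler_sum => j _.
  rewrite hahn_seqZ normcM normc_real ger0_norm// ler_piMr//.
  by rewrite normc_nat lern1 leq_b1.
have v0 : v = 0.
  apply: hahn_ext => k; apply/eq0_normc/eqP; rewrite eq_le normc_ge0 andbT.
  apply/ler_addgt0Pr => e e0; rewrite add0r; have e2 : 0 < e / 2 by rewrite divr_gt0.
  have [|N /= SN vN] := clu (e / 2) [set N | (d N)^-1 <= e / 2] e2.
    case: dP => _ _ /cvgryPge/(_ (e / 2)^-1); apply: filterS => N h /=.
    by rewrite -[leRHS]invrK lef_pV2 ?posrE ?invr_gt0.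
  rewrite -[v k](subrK (w N k)) [e]splitr; apply: le_trans (le_normcD _ _) _.
  apply: lerD; first exact/ltW/hahn_coord_dist.
  exact: le_trans (wk N k) SN.
have [||N _] := clu 2^-1 setT; [by []|exact: filterT|].
rewrite v0 sub0r normrN hahn_normE ltcR ltNge => /negP; apply.
(* From [N] on, [w N] is [N.+1 / (k.+1 * d N)] at [k]. As [d k >= d N], its increments for
   [N <= k < 2N+1] contribute at least [N.+1 * (1/(N+1) - 1/(2N+2)) = 1/2]. *)
apply: le_trans (hahn_partial_le (w N) (N + N.+1)).
rewrite (big_cat_nat (n := N)) ?leq_addr//=; apply: ler_wpDl.
  by apply: sumr_ge0 => k _; rewrite mulr_ge0 ?normc_ge0// ltW.
have diffE k : (N <= k)%N ->
    normc (w N k.+1 - w N k) = (d N)^-1 * (N.+1%:R * (k.+1%:R^-1 - k.+2%:R^-1)).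
  move=> Nk; rewrite CE cesaro_diff.
  rewrite (eq_bigr (fun j => if j == N then - (((d N)^-1)%:C * N.+1%:R) else 0)).
    rewrite -big_mkcond big_nat1_eq /= ltnS Nk normcM normcN normcV !normcM.
    rewrite !normc_nat normc_real ger0_norm// -mulrA; congr (_ * (_ * _)).
    have e : k.+2%:R = k.+1%:R + 1 :> R by rewrite natr1.
    have n2 : k.+2%:R != 0 :> R by rewrite pnatr_eq0.
    have n1 : k.+1%:R != 0 :> R by rewrite pnatr_eq0.
    move: n1 n2; rewrite e; move: (k.+1%:R : R) => q n1 n2.
    by field; rewrite n1 n2.
  move=> j _; rewrite !hahn_seqZ -mulrBr step_seq_diff.
  by case: eqVneq => [->|_]; ring.
apply: (@le_trans _ _ (\sum_(N <= k < N + N.+1) N.+1%:R * (k.+1%:R^-1 - k.+2%:R^-1))).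
  rewrite -mulr_sumr (eq_bigr (fun k => - (k.+2%:R^-1 - k.+1%:R^-1))); last first.
    by move=> k _; rewrite opprB.
  rewrite sumrN (@telescope_sumr _ _ _ (fun k => k.+1%:R^-1 : R)) ?leq_addr//.
  rewrite opprB -addSn natrD.
  have : N.+1%:R != 0 :> R by rewrite pnatr_eq0.
  move: (N.+1%:R : R) => q q0; have -> : q + q = 2 * q by ring.
  rewrite le_eqVlt; apply/orP; left; apply/eqP; field.
  by rewrite q0.
apply: ler_sum_nat => k /andP[Nk _].
rewrite diffE// [leRHS]mulrA; apply: ler_peMl.
  rewrite mulr_ge0// subr_ge0 lef_pV2 ?posrE// ler_nat leqnSn//.
rewrite ler_pdivlMr// mul1r.
by case: dP => _ dm _; exact: dm.
Qed.

End CesaroOp.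

(** * Eigenvectors of the dual operator *)

Section EigenCoef.
Variable R : realType.

Lemma normc_sqr (z : R[i]) : normc z ^+ 2 = complex.Re z ^+ 2 + complex.Im z ^+ 2.
Proof. by case: z => a b /=; rewrite sqr_sqrtr// addr_ge0 ?sqr_ge0. Qed.

(** Squaring turns the disc into [a^2 + b^2 < a] for [z = a + ib], and the real part of [1/z] is
    [a / (a^2 + b^2)]. *)
Lemma disc_Re_inv (z : R[i]) : `|z - 2^-1| < 2^-1 ->
  z != 0 /\ 1 < complex.Re z^-1.
Proof.
have -> : 2^-1 = (2^-1)%:C :> R[i] by rewrite fmorphV rmorph_nat.
rewrite [`|_|]/((normc _)%:C) ltcR => h.
have {h} : normc (z - (2^-1)%:C) ^+ 2 < 2^-1 ^+ 2.
  by rewrite ltr_pXn2r ?nnegrE ?normc_ge0.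
rewrite normc_sqr; case: z => a b; rewrite /= subr0 => h.
have ab : a ^+ 2 + b ^+ 2 < a by lra.
have a0 : 0 < a by apply: le_lt_trans ab; rewrite addr_ge0 ?sqr_ge0.
split; first by rewrite eq_complex /= negb_and lt0r_neq0.
by rewrite ltr_pdivlMr ?mul1r// ltr_wpDr ?sqr_ge0// exprn_gt0.
Qed.

(** The dual equation reads [\sum_(n >= k) f n / n.+1 = z * f k]; subtracting it at [k.+1] gives
    [f k.+1 = f k * (1 - mu / k.+1)] with [mu = 1/z]. *)
Definition eigen_coef (mu : R[i]) n : R[i] := \prod_(k < n) (1 - mu / k.+1%:R).

Lemma eigen_coef0 mu : eigen_coef mu 0 = 1.
Proof. by rewrite /eigen_coef big_ord0. Qed.

Lemma eigen_coefS mu n :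
  eigen_coef mu n.+1 = eigen_coef mu n * (1 - mu / n.+1%:R).
Proof. by rewrite /eigen_coef big_ord_recr. Qed.

(** The first bound makes the coefficients a continuous functional; the second controls the boundary
    term in its eigenvalue equation. *)
Lemma eigen_coef_bound mu : 1 < complex.Re mu \/ mu = 1 ->
  exists B, forall n, \sum_(0 <= k < n) normc (eigen_coef mu k) <= B /\
    n%:R * normc (eigen_coef mu n) <= B.
Proof.
have [->|mu1] := eqVneq mu 1 => [_|].
  have z n : eigen_coef 1 n.+1 = 0.
    by rewrite /eigen_coef big_ord_recl /= divr1 subrr mul0r.
  exists 1 => -[|n]; first by rewrite big_geq// mul0r.
  rewrite z normc0 mulr0 big_nat_recl// eigen_coef0 normc1 big1 ?addr0//.
  by move=> k _; rewrite z normc0.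
case=> [a1|/eqP]; last by rewrite (negPf mu1).
set a := complex.Re mu in a1; set b := complex.Im mu.
(* The modulus of [n.+1 - mu] is about [n - 2 * c]; giving up one [c] leaves room for the imaginary
   part. *)
pose c := (a - 1) / 2; have c0 : 0 < c by rewrite divr_gt0// subr_gt0.
pose g n := normc (eigen_coef mu n).
have g0 n : 0 <= g n by exact: normc_ge0.
pose D n := c * \sum_(0 <= k < n) g k + n%:R * g n.
(* The first condition makes [n - c] nonnegative, so squares can be compared; the second makes the
   squared inequality hold. *)
have [N hN] : exists N : nat, forall n, (N <= n)%N ->
    c <= n%:R /\ a ^+ 2 + b ^+ 2 <= (a - 1) * n.+1%:R.
  exists (maxn (Num.truncn c).+1 (Num.truncn ((a ^+ 2 + b ^+ 2) / (a - 1))).+1).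
  move=> n; rewrite geq_max => /andP[h1 h2]; split.
    by apply/ltW/(lt_le_trans (truncnS_gt _)); rewrite ler_nat.
  rewrite mulrC -ler_pdivrMr ?subr_gt0//; apply/ltW/(lt_le_trans (truncnS_gt _)).
  by rewrite ler_nat leqW.
(* [n.+1 * `|1 - mu / n.+1| <= n - c], seen by squaring, makes [D] eventually
   nonincreasing. *)
have Dle n : (N <= n)%N -> D n.+1 <= D n.
  move=> /hN[cn abn]; rewrite /D big_nat_recr//= mulrDr -addrA lerD2l.
  suff : n.+1%:R * g n.+1 <= (n%:R - c) * g n by rewrite mulrBl; lra.
  rewrite /g eigen_coefS normcM mulrCA mulrC ler_wpM2r ?normc_ge0//.
  rewrite -(normc_nat R n.+1) -normcM mulrBr mulr1 mulrCA divff ?pnatr_eq0// mulr1.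
  rewrite -(@ler_pXn2r _ 2) ?nnegrE ?normc_ge0 ?subr_ge0//.
  rewrite normc_sqr.
  have -> : n.+1%:R = (n.+1%:R)%:C :> R[i] by rewrite rmorph_nat.
  have -> : complex.Re ((n.+1%:R)%:C - mu) = n%:R + 1 - a.
    by rewrite natr1 /a; case: (mu).
  have -> : complex.Im ((n.+1%:R)%:C - mu) = - b.
    by rewrite /b; case: (mu) => p q /=; rewrite sub0r.
  move: abn; rewrite -natr1 /c; have := sqr_ge0 (a + 1).
  by move: (n%:R : R) => q; lra.
have DN m : D (N + m)%N <= D N.
  by elim: m => [|m ih]; rewrite ?addn0// addnS (le_trans (Dle _ _)) ?leq_addr.
have D0 n : 0 <= D n.
  by apply: addr_ge0; apply: mulr_ge0 => //; [exact: ltW|exact: sumr_ge0].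
(* Since [D] is nonnegative, this sum dominates its values up to [N]. *)
pose B := \sum_(0 <= k < N.+1) D k.
have DB n : D n <= B.
  have DkB k : (k <= N)%N -> D k <= B.
    move=> kN; rewrite /B (bigD1_seq k) ?mem_index_iota ?iota_uniq//=.
    by rewrite lerDl sumr_ge0.
  have [/DkB//|/ltnW/subnKC <-] := leqP n N.
  exact: le_trans (DN _) (DkB N _).
have B0 : 0 <= B by exact: le_trans (DB 0%N).
have Bc : 0 <= B / c by rewrite divr_ge0// ltW.
exists (B / c + B) => n; split.
  apply: (@le_trans _ _ (B / c)); last by rewrite lerDl.
  rewrite ler_pdivlMr// mulrC; apply: le_trans (DB n); rewrite lerDl.
  by rewrite mulr_ge0.
apply: (@le_trans _ _ B); last by rewrite lerDr.
apply: le_trans (DB n); rewrite lerDr mulr_ge0 ?(ltW c0)//.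
by rewrite sumr_ge0.
Qed.

End EigenCoef.

(** * Functionals with summable coefficients *)

Section Functional.
Variables (R : realType) (d : nat -> R) (dP : hahn_weight d).
Local Notation H := (hahn_space dP).

(** Coordinates are bounded by the norm, so the series converges absolutely and [B] bounds the
    functional. *)
Lemma summable_dual (f : nat -> R[i]) (B : R) :
  (forall n, \sum_(0 <= k < n) normc (f k) <= B) ->
  exists F : dual H, forall u : H,
    series (fun k => f k * u k : R[i]^o) @ \oo --> F u.
Proof.
move=> fB; have B0 : 0 <= B by have := fB 0%N; rewrite big_geq.
have bnd (u : H) n :
    \sum_(0 <= k < n) normc (f k * u k) <= B * fine (hahn_sum d u).
  apply: (@le_trans _ _ (\sum_(0 <= k < n) normc (f k) * fine (hahn_sum d u))).
    apply: ler_sum => k _; rewrite normcM ler_wpM2l ?normc_ge0//.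
    exact: hahn_coord_le.
  by rewrite -mulr_suml ler_wpM2r// fine_ge0// hahn_sum_ge0.
pose S (u : H) : nat -> R[i]^o := series (fun k => f k * u k : R[i]^o).
have Scvg u : S u @ \oo --> limn (S u) by exact: cvg_series_normc (bnd u).
suff FP : (fun u => limn (S u) : R[i]^o) \in @bounded_op_pred _ H R[i]^o.
  by exists (BoundedOp FP) => u; exact: Scvg.
apply: (@bounded_op_predP _ _ _ _ B) => [a u v|u].
  apply: cvg_lim => //.
  have -> : S (a *: u + v) = fun n => a *: S u n + S v n.
    apply/funext => n; rewrite /S /series /= scaler_sumr -big_split/=.
    apply: eq_bigr => k _; rewrite -[RHS]/(a * (f k * u k) + f k * v k).
    by rewrite mulrCA -mulrDr.
  by apply: cvgD; [apply: cvgZl_tmp|]; exact: Scvg.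
rewrite hahn_normE [`|_|]/((normc _)%:C) -rmorphM lecR.
apply: cvg_normc_le (Scvg u) _ => n.
exact: le_trans (normc_sum _ _ _) (bnd u n).
Qed.

Variable C : bounded_op H H.
Hypothesis CE : forall x : H, hahn_seq (C x) = cesaro_seq (hahn_seq x).

Lemma cesaro_dual_eigen (z : R[i]) : z != 0 ->
  1 < complex.Re z^-1 \/ z = 1 -> point_spectrum (dual_op C) z.
Proof.
move=> z0 hz; pose f := eigen_coef z^-1.
have [|B fB] := @eigen_coef_bound _ z^-1.
  by case: hz => [|->]; [left|right; rewrite invr1].
have [F FE] := summable_dual (fun n => (fB n).1).
exists F.
  have F1 : series (fun k => f k * step dP 0 k : R[i]^o) @ \oo --> (1 : R[i]^o).
    apply: cvg_near_cst; exists 1%N => // -[|n] // _.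
    rewrite /series /= big_nat_recl// /f eigen_coef0 mul1r.
    by rewrite big1 ?addr0// => k _; rewrite mulr0.
  have F1E : F (step dP 0) = 1 :> R[i].
    apply: (@cvg_unique R[i]^o (@norm_hausdorff _ _) _ _ _ _ (FE (step dP 0)) F1).
  apply/eqP => F0; have : 1 = 0 :> R[i] by rewrite -F1E F0.
  by move/eqP; rewrite oner_eq0.
apply/val_inj/funext => u /=.
rewrite -[RHS]/(z * F u).
apply: (@cvg_unique R[i]^o (@norm_hausdorff _ _) _ _ _ _ (FE (C u))).
pose S n : R[i] := \sum_(0 <= k < n) u k.
(* Summation by parts: the eigenvalue equation holds for partial sums up to the boundary term
   [f n * S n]. *)
have E n : \sum_(0 <= k < n) f k * (C u) k =
    z * (\sum_(0 <= k < n) f k * u k - f n * S n) :> R[i].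
  elim: n => [|n ih]; first by rewrite /S !big_geq// mulr0 subrr mulr0.
  have SS : S n.+1 = S n + u n by rewrite /S big_nat_recr.
  have CS : (C u) n = S n.+1 / n.+1%:R :> R[i].
    by rewrite CE /cesaro_seq -(big_mkord xpredT (hahn_seq u)).
  have fS : f n.+1 = f n * (1 - z^-1 / n.+1%:R) by exact: eigen_coefS.
  rewrite !big_nat_recr//= ih CS SS fS.
  have n1 : n.+1%:R != 0 :> R[i] by rewrite pnatr_eq0.
  move: n1; move: (n.+1%:R : R[i]) => q q0; field.
  by rewrite z0 q0.
have -> : series (fun k => f k * (C u) k : R[i]^o) =
    fun n => z * (series (fun k => f k * u k : R[i]^o) n - f n * S n).
  by apply/funext => n; exact: E.
(* This is the bounded [n * f n] times the mean [S n / n], which tends to 0. *)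
have fS0 : (fun n => f n * S n : R[i]^o) @ \oo --> (0 : R[i]^o).
  rewrite -cvg_shiftS; apply/cvgC_normc; under eq_fun do rewrite subr0.
  have /cvgC_normc y0 := cesaro_cvg0 (hahn_cvg0 u).
  have By0 : B * normc (cesaro_seq u n - 0) @[n --> \oo] --> (0 : R).
    by rewrite -[X in _ --> X](mulr0 B); exact: cvgMr.
  apply: squeeze_cvgr (cvg_cst 0) By0; apply: nearW => n.
  rewrite normc_ge0 subr0 /=.
  have -> : f n.+1 * S n.+1 = n.+1%:R * f n.+1 * cesaro_seq u n :> R[i].
    rewrite /cesaro_seq -(big_mkord xpredT (hahn_seq u)) -/(S n.+1).
    have n1 : n.+1%:R != 0 :> R[i] by rewrite pnatr_eq0.
    by field.
  rewrite normcM ler_wpM2r ?normc_ge0// normcM normc_nat.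
  exact: (fB n.+1).2.
rewrite -[F u]subr0; apply: (@cvgMr R[i]); exact: cvgB (FE u) fS0.
Qed.

End Functional.

(** * Spectra and dual eigenvectors *)

Section Spectra.
Variables (R : realType) (X : normedModType R[i]) (T : bounded_op X X).

Lemma dual_eigen_range (l : R[i]) (f : dual X) x :
  dual_op T f = l *: f -> f (l *: x - T x) = 0.
Proof.
move=> /(congr1 (fun g : dual X => g x)) fT.
have {}fT : f (T x) = l *: f x by exact: fT.
by rewrite bounded_opB bounded_opZ fT subrr.
Qed.

(** An eigenvector vanishes on the range; by continuity it would vanish everywhere if the range were
    dense. *)
Lemma dual_eigen_not_dense (l : R[i]) : point_spectrum (dual_op T) l ->
  ~ dense (range (fun x => l *: x - T x)).
Proof.
move=> [f f0 fT] /dense_normC dT; move/eqP: f0; apply.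
have [M M0 fM] := bounded_op_bound f.
apply/val_inj/funext => v /=; apply/eq0_normc/eqP.
rewrite eq_le normc_ge0 andbT; apply/ler_addgt0Pr => e e0; rewrite add0r.
have [_ [x _ <-] vx] := dT v (e / M) (divr_gt0 e0 M0).
rewrite -lecR -[f v]subr0 -(dual_eigen_range x fT) -bounded_opB.
apply: le_trans (fM _) _.
apply: (@le_trans _ _ (M%:C * (e / M)%:C)).
  by rewrite ler_wpM2l ?ltW// ltcR.
by rewrite -rmorphM mulrC divfK// lt0r_neq0.
Qed.

Lemma dual_eigen_residual (l : R[i]) : ~ point_spectrum T l ->
  point_spectrum (dual_op T) l -> residual_spectrum T l.
Proof.
move=> Tl Tl'; split; last exact: dual_eigen_not_dense.
move=> x y xy; apply/eqP; rewrite -subr_eq0; apply/negPn/negP => xy0.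
apply: Tl; exists (x - y) => //; rewrite bounded_opB scalerBr.
have /eqP : l *: x - T x = l *: y - T y by exact: xy.
by rewrite subr_eq => /eqP ->; rewrite [RHS]addrC addrA addKr addrC.
Qed.

(* If [l] is in the resolvent set, an eigenvector [f] of the dual operator at
   [m] satisfies [f = (l - m) *: f \o S] with [S] the resolvent at [l]; for
   [m] close to [l] this contraction forces [f = 0]. *)
Lemma spectrum_closure_dual_eigen (l : R[i]) :
  (forall e : R, 0 < e -> exists2 m,
     point_spectrum (dual_op T) m & normc (l - m) < e) ->
  spectrum T l.
Proof.
move=> lm [S [S1 S2]].
have [K K0 SK] := bounded_op_bound S.
have KP : 0 < (2 * K)^-1 by rewrite invr_gt0 mulr_gt0.
have [m [f f0 fT] lmK] := lm _ KP.
move/eqP: f0; apply.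
have [M M0 fM] := bounded_op_bound f.
have fS y : f y = (l - m) * f (S y).
  rewrite -[in LHS](S2 y) bounded_opB bounded_opZ.
  have -> : f (T (S y)) = m *: f (S y).
    by have := congr1 (fun g : dual X => g (S y)) fT.
  by rewrite -scalerBl.
(* Each use of [fS] costs a factor [normc (l - m) * K], at most 1/2 by the choice of [m]. *)
have bnd n y : `|f y| <= (M / 2 ^+ n)%:C * `|y|.
  elim: n y => [|n ih] y; first by rewrite divr1.
  rewrite fS normrM.
  apply: le_trans (ler_wpM2l _ (ih _)) _ => //.
  apply: le_trans (ler_wpM2l _ (ler_wpM2l _ (SK y))) _ => //.
    by rewrite lecR divr_ge0// ltW.
  have E : `|l - m| * (M / 2 ^+ n)%:C * K%:C =
      (normc (l - m) * (M / 2 ^+ n) * K)%:C by rewrite !rmorphM.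
  rewrite !mulrA E ler_wpM2r// lecR.
  have lK : normc (l - m) * K <= 2^-1.
    by apply/ltW; rewrite -ltr_pdivlMr// -invfM.
  rewrite mulrAC; apply: le_trans (ler_wpM2r _ lK) _; first by rewrite divr_ge0// ltW.
  by rewrite exprS invfM mulrCA.
apply/val_inj/funext => v /=; apply/eq0_normc/eqP.
rewrite eq_le normc_ge0 andbT.
have vE : (complex.Re `|v|)%:C = `|v| by rewrite RRe_real// normr_real.
have h1 : `|2^-1 : R| < 1 by rewrite ger0_norm// invf_lt1// ltr1n.
apply: (cvgr_to_ge (cvg_geometric (M * complex.Re `|v|) h1)).
apply: nearW => n; rewrite /geometric /= exprVn mulrAC -lecR.
have -> : (M / 2 ^+ n * complex.Re `|v|)%:C = (M / 2 ^+ n)%:C * `|v|.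
  by rewrite -[in RHS]vE rmorphM.
exact: bnd.
Qed.

End Spectra.

Lemma closed_disc_approx (R : realType) (z : R[i]) (e : R) :
  `|z - 2^-1| <= 2^-1 -> 0 < e ->
  exists2 m : R[i], `|m - 2^-1| < 2^-1 & normc (z - m) < e.
Proof.
have -> : 2^-1 = (2^-1)%:C :> R[i] by rewrite fmorphV rmorph_nat.
set h : R[i] := (2^-1)%:C; rewrite [`|_|]/((normc _)%:C) lecR => zh e0.
(* Moving [z] towards the centre by a fraction [t] with [t < 1] and [t < e] enters the open disc and
   shifts [z] by at most [t / 2]. *)
pose t := e / (1 + e).
have e1 : 0 < 1 + e by rewrite addr_gt0.
have t0 : 0 < t by rewrite divr_gt0.
have t1 : t < 1 by rewrite ltr_pdivrMr// mul1r ltrDr.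
have te : t < e by rewrite ltr_pdivrMr// ltr_pMr// ltrDl.
exists (z + t%:C * (h - z)).
  have -> : z + t%:C * (h - z) - h = (1 - t)%:C * (z - h).
    by rewrite rmorphB rmorph1; ring.
  rewrite [`|_|]/((normc _)%:C) ltcR normcM normc_real ger0_norm ?subr_ge0 1?ltW//.
  apply: (@le_lt_trans _ _ ((1 - t) * 2^-1)); last lra.
  by rewrite ler_wpM2l// subr_ge0 ltW.
have -> : z - (z + t%:C * (h - z)) = t%:C * (z - h) by ring.
rewrite normcM normc_real gtr0_norm//.
by apply: (@le_lt_trans _ _ (t * 2^-1)); [rewrite ler_wpM2l// ltW|lra].
Qed.

(* Assembly of the four claims *)
Local Close Scope complex_scope.

Theorem proposition12p8 (R : realType) :
  let d : nat -> R := fun n => ln (n + 3)%:R in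
  hahn_weight d /\
  forall dP : hahn_weight d,
  (* (i) *)
  (forall x : nat -> R[i]^o, x \in hahn d -> cesaro_seq x \in hahn d) /\
  exists C1 : bounded_op (hahn_space dP) (hahn_space dP),
    [/\ forall x : hahn_space dP, hahn_seq (C1 x) = cesaro_seq (hahn_seq x),
  (* (ii) *)
        point_spectrum C1 = set0,
  (* (iii) *)
        [/\ [set z : R[i] | `|z - 2^-1| < 2^-1] `|` [set 1]
              `<=` point_spectrum (dual_op C1),
            point_spectrum (dual_op C1) `<=` residual_spectrum C1 &
            [set z : R[i] | `|z - 2^-1| <= 2^-1] `<=` spectrum C1] &
  (* (iv) *)
        [/\ ~ compact_op C1, ~ mean_ergodic C1 & ~ supercyclic C1]].
Proof.
move=> d; split; first exact: ln_hahn_weight.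
move=> dP; have dd : forall n, d n.+1 - d n <= n.+1%:R^-1 by exact: ln_succ_le.
split; first exact: cesaro_hahn dP dd.
have [C CE] := cesaro_op_exists dP dd; exists C.
have pt0 : point_spectrum C = set0.
  by rewrite -subset0 => l [x /eqP + Cx]; apply; apply: (cesaro_eigen0 CE Cx).
have disc : [set z : R[i] | `|z - 2^-1| < 2^-1] `|` [set 1]
    `<=` point_spectrum (dual_op C).
  move=> z [/disc_Re_inv[z0 z1]|->]; first by apply: (cesaro_dual_eigen CE) => //; left.
  by apply: (cesaro_dual_eigen CE); [exact: oner_neq0|right].
split => //; first split => //.
- by move=> l; apply: dual_eigen_residual; rewrite pt0.
- move=> z zh; apply: spectrum_closure_dual_eigen => e e0.
  have [m mh zm] := closed_disc_approx zh e0.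
  by exists m => //; apply: disc; left.
- split; [exact: cesaro_not_compact|exact: cesaro_not_mean_ergodic|].
  exact: cesaro_not_supercyclic.
Qed.
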